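(* Any standard resizable array data structure that uses only $N+O(rN^{1/r})$ space to store an array of size $N$, where $r=O(\log N)$, must have an amortized cost of $\Omega(r)$ for grow operations.
   Context: A resizable array stores a sequence $a_0,\dots,a_{N-1}$ ($N$ is its current size) and supports: creating an empty array, returning its length, reading or overwriting the $i$-th item, Grow$(a)$ which appends a new last item, and Shrink() which removes the last item. An implementation keeps its data in dynamically allocated fixed-length contiguous blocks of memory words; each item occupies one word and each pointer one word; every block other than a single main index block must be pointed to from some block. The space used at any moment is the total length of all currently allocated blocks. For non-decreasing functions $s,t$, an $(s(N),t(N))$-implementation uses at most $N+s(N)$ space to store an array of size $N$, and at most $N+t(N)$ space at any moment during a grow or shrink operation. Such an implementation is standard if: (i) whenever a new block $B$ is allocated, items from some other blocks $A_1,\dots,A_k$ are immediately copied into it in sequential order — all items of $A_1$ into the first positions of $B$, then $A_1$ is released, then the items of $A_2$ into the next positions, then $A_2$ is released, and so on; and (ii) following each such operation the total space used is $N+s(N)$ (within the storage bound). The cost of an operation counts item assignments (copying or writing an item into a block). *)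

(* Defs.v *)
From HB Require Import structures.
From mathcomp Require Import all_boot all_order all_algebra finmap.
From mathcomp Require Import all_classical all_reals all_analysis.

Set Implicit Arguments.
Unset Strict Implicit.
Unset Printing Implicit Defensive.

Import Order.TTheory GRing.Theory Num.Theory.

Local Open Scope fmap_scope.
Local Open Scope nat_scope.

(* A block is named by its address; a location is an address and an offset. *)
Definition address := nat.
Definition location := (address * nat)%type.

Inductive word (T : Type) : Type :=
  | Item of T
  | Pointer of address
  | Data of nat.

Arguments Pointer {T}.
Arguments Data {T}.

(* All the data is in the allocated blocks, except for the address of the
   main index block. *)
Record state (T : Type) := State {
  heap : {fmap address -> seq (word T)};
  index_block : address
}.

Definition state0 (T : Type) : state T := State [fmap] 0.

Definition space_used (T : Type) (sg : state T) : nat :=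
  \sum_(b : domf (heap sg)) size (heap sg b).

Definition lookup (T : Type) (sg : state T) (l : location) : option (word T) :=
  obind (fun ws => onth ws l.2) (heap sg).[? l.1].

Definition store (T : Type) (sg : state T) (l : location) (w : word T) :
    option (state T) :=
  if (heap sg).[? l.1] is Some ws then
    if l.2 < size ws then
      Some (State (heap sg).[l.1 <- set_nth w ws l.2 w] (index_block sg))
    else None
  else None.

(* [Put] writes the item that is the argument of the current operation; it and
   [Copy] are the only ways to make a word hold an item.  [PutData] can in
   particular discard an item that is no longer needed. *)
Inductive instr : Type :=
  | Alloc (b : address) (len : nat)
  | Free (b : address)
  | Copy (src dst : location)
  | Put (dst : location)
  | PutPointer (dst : location) (b : address)
  | PutData (dst : location) (k : nat)
  | SetIndexBlock (b : address).

(* [None] is a fault; [x] is the argument item of the operation, if any. *)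
Definition exec1 (T : Type) (x : option T) (sg : state T) (i : instr) :
    option (state T) :=
  match i with
  | Alloc b len =>
      if b \in domf (heap sg) then None
      else Some (State (heap sg).[b <- nseq len (Data 0)] (index_block sg))
  | Free b =>
      if b \in domf (heap sg) then Some (State (heap sg).[~ b] (index_block sg))
      else None
  | Copy src dst =>
      if lookup sg src is Some (Item y) then store sg dst (Item y) else None
  | Put dst => if x is Some y then store sg dst (Item y) else None
  | PutPointer dst b => store sg dst (Pointer b)
  | PutData dst k => store sg dst (Data k)
  | SetIndexBlock b => Some (State (heap sg) b)
  end.

Fixpoint exec (T : Type) (x : option T) (sg : state T) (p : seq instr) :
    option (state T) :=
  if p is i :: p' then obind (fun sg' => exec x sg' p') (exec1 x sg i)
  else Some sg.

Definition is_assignment (i : instr) : bool :=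
  match i with Copy _ _ | Put _ => true | _ => false end.

Definition cost (p : seq instr) : nat := count is_assignment p.

Inductive op (T : Type) : Type :=
  | Grow of T
  | Shrink
  | Overwrite of nat & T.

Arguments Shrink {T}.

Definition op_arg (T : Type) (o : op T) : option T :=
  match o with Grow x => Some x | Shrink => None | Overwrite _ x => Some x end.

(* [None] when the operation is not allowed on the array. *)
Definition apply_op (T : Type) (a : seq T) (o : op T) : option (seq T) :=
  match o with
  | Grow x => Some (rcons a x)
  | Shrink => if a is y :: a' then Some (belast y a') else None
  | Overwrite i x => if i < size a then Some (set_nth x a i x) else None
  end.

Record implementation (T : Type) := Implementation {
  create : seq instr;
  program : state T -> op T -> seq instr;
  len : state T -> nat;
  loc : state T -> nat -> location  (* where the i-th item is read *)
}.

(* [reachable A sg a]: some legal sequence of operations, starting with the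
   creation of an empty array, leads to memory [sg] and array [a]. *)
Inductive reachable (T : Type) (A : implementation T) :
    state T -> seq T -> Prop :=
  | reachable_create sg :
      exec None (state0 T) (create A) = Some sg -> reachable A sg [::]
  | reachable_op sg a o a' sg' :
      reachable A sg a -> apply_op a o = Some a' ->
      exec (op_arg o) sg (program A sg o) = Some sg' ->
      reachable A sg' a'.

Definition well_pointed (T : Type) (sg : state T) : Prop :=
  index_block sg \in domf (heap sg) /\
  forall b, b \in domf (heap sg) -> b != index_block sg ->
    exists l, lookup sg l = Some (Pointer b).

(* Each item occupies a word of its own. *)
Definition represents (T : Type) (A : implementation T)
    (sg : state T) (a : seq T) : Prop :=
  [/\ len A sg = size a,
      {in gtn (size a) &, injective (loc A sg)} &
      forall i, i < size a ->
        lookup sg (loc A sg i) = omap (@Item T) (onth a i)].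

Definition correct (T : Type) (A : implementation T) : Prop :=
  (exists sg, exec None (state0 T) (create A) = Some sg) /\
  forall sg a, reachable A sg a ->
    [/\ represents A sg a, well_pointed sg &
        forall o a', apply_op a o = Some a' ->
          exists sg', exec (op_arg o) sg (program A sg o) = Some sg'].

(* During an operation that changes the size of the array from N to N', the
   bounds below are taken at [maxn N N']. *)
Definition st_implementation (R : numDomainType) (T : Type)
    (s t : nat -> R) (A : implementation T) : Prop :=
  [/\ {homo s : m n / m <= n >-> (m <= n)%R},
      {homo t : m n / m <= n >-> (m <= n)%R},
      correct A,
      forall sg a, reachable A sg a ->
        ((space_used sg)%:R <= (size a)%:R + s (size a))%R &
      forall sg a o a' p1 p2 tau,
        reachable A sg a -> apply_op a o = Some a' ->
        size a' != size a ->
        program A sg o = p1 ++ p2 ->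
        exec (op_arg o) sg p1 = Some tau ->
        ((space_used tau)%:R <= (maxn (size a) (size a'))%:R
                           + t (maxn (size a) (size a')))%R].

(* Offsets of the words of block [A] that hold an item, in increasing order. *)
Definition item_offsets (T : Type) (tau : state T) (A : address) : seq nat :=
  let ws := odflt [::] (heap tau).[? A] in
  [seq p <- iota 0 (size ws) | if onth ws p is Some (Item _) then true else false].

(* Moves the items of the blocks [As], in this order, to consecutive words of
   [B] starting at offset [off], and frees each block once it is emptied. *)
Fixpoint transfer (T : Type) (tau : state T) (B : address) (off : nat)
    (As : seq address) : seq instr :=
  if As is A :: As' then
    let ps := item_offsets tau A in
    [seq Copy (A, nth 0 ps k) (B, off + k) | k <- iota 0 (size ps)]
    ++ Free A :: transfer tau B (off + size ps) As'
  else [::].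

Definition standard_execution (R : numDomainType) (T : Type) (s : nat -> R)
    (N : nat) (x : option T) (sg : state T) (p : seq instr) : Prop :=
  forall p1 B n p2 tau,
    p = p1 ++ Alloc B n :: p2 -> exec x sg p1 = Some tau ->
    exists (As : seq address) (p3 : seq instr),
      [/\ B \notin As,
          p2 = transfer tau B 0 As ++ p3 &
          forall tau', exec x tau (Alloc B n :: transfer tau B 0 As) = Some tau' ->
            ((space_used tau')%:R <= N%:R + s N)%R].

Definition standard (R : numDomainType) (T : Type) (s : nat -> R)
    (A : implementation T) : Prop :=
  standard_execution s 0 None (state0 T) (create A) /\
  forall sg a o a', reachable A sg a -> apply_op a o = Some a' ->
    standard_execution s (maxn (size a) (size a')) (op_arg o) sg
      (program A sg o).

Fixpoint grow_cost (T : Type) (A : implementation T) (sg : state T)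
    (xs : seq T) : nat :=
  if xs is x :: xs' then
    let p := program A sg (Grow x) in
    cost p + (if exec (Some x) sg p is Some sg' then grow_cost A sg' xs' else 0)
  else 0.

(* Total cost of growing an initially empty array by the items [xs]. *)
Definition total_grow_cost (T : Type) (A : implementation T) (xs : seq T) : nat :=
  if exec None (state0 T) (create A) is Some sg then grow_cost A sg xs else 0.

Definition amortized_grow_cost (R : numFieldType) (T : Type)
    (A : implementation T) (xs : seq T) : R :=
  ((total_grow_cost A xs)%:R / (size xs)%:R)%R.

(* Main.v *)
(* Between operations an array of size [N] leaves room for at most [S] words
   that hold no item, where [S] bounds [s]; every block but one takes a word
   for its pointer, so there are at most [S.+1] blocks.

   Fix the whole run of [n] grows.  Look at it backwards: an item in a block
   that is freed at time [z] has to be rewritten at time [z], and, apart from at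
   most [S] free words of older blocks, only blocks allocated at time [z] can
   receive it.  Let [lam z] be the least number of rewrites until the end of
   the run, over the blocks allocated at time [z], truncated at [d].  Charging
   each written word the number of its remaining rewrites gives a potential
   which shows that the cost is at least [d] per item, up to [2 S + 1] items for
   each time [z] with [lam z < d].  For each such [z] keep one block that attains
   the minimum.  The lifetimes of these blocks form a forest of intervals of
   depth less than [d], at most [S.+1] of which contain a given time, so there
   are fewer than ['C(S.+1 + d.-1, d.-1)] of them.  With [S = O(r n^(1/r))] and
   [d] a small multiple of [r] this is at most [n^(1/4)]. *)

Require Import Defs.
From HB Require Import structures.
From mathcomp Require Import all_boot all_order all_algebra finmap.
From mathcomp Require Import all_classical all_reals all_analysis.
From mathcomp Require Import zify lra ring.

Set Implicit Arguments.
Unset Strict Implicit.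
Unset Printing Implicit Defensive.

Import Order.TTheory GRing.Theory Num.Theory.
Local Open Scope nat_scope.

(** * Counting forests of intervals *)

Lemma count_predUC (T : Type) (P D : pred T) (s : seq T) :
  count P s = count (fun z => P z && ~~ D z) s + count (fun z => P z && D z) s.
Proof. by elim: s => //= z s ->; case: (P z) (D z) => [] [] /=; lia. Qed.

(** Consecutive intervals on the way up from [z] to the root [c] abut, so together they tile the
    times from [z] up to [N]. *)
Lemma cover_chain (par : nat -> nat) (N c : nat) (P : pred nat) (t z : nat) :
    (forall z, z < par z) ->
    (forall z, z < N -> P z -> par z = N \/ par z < N /\ P (par z)) ->
    par c = N -> t < N -> P z -> z <= t -> (exists k, iter k par z = c) ->
  exists z', [/\ P z', (exists k, iter k par z' = c) & z' <= t < par z'].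
Proof.
move=> par_gt parP parc tN.
have [m] := ubnP (t - z); elim: m z => // m IHm z ltm Pz zt [k zc].
have [tlt|parle] := ltnP t (par z); first by exists z; split; [|exists k|rewrite zt].
have zN : z < N by have := par_gt z; lia.
case: (parP z zN Pz) => [pN|[_ Ppz]]; first by lia.
case: k zc => [/= zc|k]; first by rewrite zc in parle; lia.
rewrite iterSr => zc; apply: (IHm (par z)) => //; last by exists k.
by have := par_gt z; lia.
Qed.

Lemma forest_root (par : nat -> nat) (N : nat) (P : pred nat) (z : nat) :
    (forall z, z < par z) ->
    (forall z, z < N -> P z -> par z = N \/ par z < N /\ P (par z)) ->
    z < N -> P z ->
  exists c, [/\ P c, c < N, par c = N & exists k, iter k par z = c].
Proof.
move=> par_gt parP; have [m] := ubnP (N - z).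
elim: m z => // m IHm z ltm zN Pz; case: (parP z zN Pz) => [pN|[pN Pp]].
  by exists z; split => //; exists 0.
have [|c [Pc cN parc [k kc]]] := IHm (par z) _ pN Pp.
  by have := par_gt z; lia.
by exists c; split => //; exists k.+1; rewrite iterSr.
Qed.

(* The path from the first interval to its root [c] covers every later time
   exactly once: hence Pascal's rule, between the descendants of [c], whose
   depth drops, and the other intervals, whose overlap drops. *)
Lemma forest_count (K e N : nat) (P : pred nat) (par dep : nat -> nat) :
    (forall z, z < par z) ->
    (forall z, z < N -> P z -> par z = N \/ par z < N /\ P (par z)) ->
    (forall z, z < N -> P z -> 0 < dep z <= e) ->
    (forall z, z < N -> P z -> par z < N -> dep (par z) < dep z) ->
    (forall t, t < N ->
      count (fun z => P z && (z <= t < par z)) (iota 0 N) <= K) ->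
  count P (iota 0 N) < 'C(K + e, e).
Proof.
move=> par_gt; have [m] := ubnP (K + e).
elim: m K e N P dep => // m IHm K e N P dep ltm parP depP dep_par over.
have [/hasP[z1 z1N Pz1]|] := boolP (has P (iota 0 N)); last first.
  by rewrite has_count -eqn0Ngt => /eqP->; rewrite bin_gt0 leq_addl.
have exP : exists z, P z && (z < N).
  by exists z1; rewrite Pz1; move: z1N; rewrite mem_iota.
case: (ex_minnP exP) => z0 /andP[Pz0 z0N] z0min.
have [c [Pc cN parc z0c]] := forest_root par_gt parP z0N Pz0.
pose desc z := `[< exists k, iter k par z = c >].
have descE z : desc z = (z == c) || desc (par z).
  apply/asboolP/orP => [[[|k]]|[/eqP->|/asboolP[k kc]]].
  - by move=> /= ->; left.
  - by rewrite iterSr => kc; right; apply/asboolP; exists k.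
  - by exists 0.
  - by exists k.+1; rewrite iterSr.
have desc_le z : desc z -> z <= c.
  move=> /asboolP[k <-]; elim: k => //= k IHk.
  by apply: leq_trans IHk (ltnW (par_gt _)).
have /andP[depc0 depce] := depP _ cN Pc.
have dep_desc z : z < N -> P z -> desc z -> z != c -> dep c < dep z.
  have [j] := ubnP (N - z); elim: j z => // j IHj z ltj zN Pz dz zc.
  move: (dz); rewrite descE (negPf zc) /= => dpz.
  have [pN|[pN Pp]] := parP z zN Pz.
    by have := desc_le _ dpz; lia.
  have := dep_par z zN Pz pN.
  have [pc|pc] := eqVneq (par z) c; first by rewrite pc.
  by move=> h; apply: ltn_trans h; apply: IHj => //; have := par_gt z; lia.
have K0 : 0 < K.
  apply: leq_trans (over z0 z0N); rewrite -has_count.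
  by apply/hasP; exists z0; rewrite ?mem_iota // Pz0 leqnn par_gt.
have eqcount : count P (iota 0 N) =
    count (fun z => P z && ~~ desc z) (iota 0 N)
    + (count (fun z => P z && desc z && (z != c)) (iota 0 c)).+1.
  rewrite (count_predUC _ desc); congr addn.
  have -> : N = c + (N - c.+1).+1 by lia.
  rewrite iotaD add0n count_cat /= -/(iota c.+1 _).
  have -> : desc c by apply/asboolP; exists 0.
  rewrite Pc /= (@eq_in_count _ _ pred0 (iota c.+1 _)); last first.
    move=> z; rewrite mem_iota => zc /=.
    by case: (boolP (desc z)) => [/desc_le|]; [lia | rewrite andbF].
  rewrite count_pred0 addn1; congr S; apply: eq_in_count => z.
  by rewrite mem_iota => zc /=; rewrite (_ : z != c) ?andbT //; lia.
have e0 : 0 < e by lia.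
(* Proper descendants of [c] start before [c], so they form a forest with end [c] in place of [N];
   their depths, measured from [dep c >= 1], are at most [e.-1]. *)
have bound_desc : count (fun z => P z && desc z && (z != c)) (iota 0 c)
    < 'C(K + e.-1, e.-1).
  apply: (IHm _ _ _ _ (fun z => dep z - dep c)) => //.
  - by lia.
  - move=> z zc /andP[/andP[Pz dz] zNc].
    have [|pN|[pN Pp]] := parP z _ Pz; first by lia.
      by move: dz; rewrite descE (negPf zNc) pN /= => /desc_le; lia.
    move: dz; rewrite descE (negPf zNc) /= => dp.
    have [->|pc] := eqVneq (par z) c; [by left | right].
    by rewrite Pp dp /=; split => //; have := desc_le _ dp; lia.
  - move=> z zc /andP[/andP[Pz dz] zNc].
    have zN : z < N by lia.
    by have := dep_desc z zN Pz dz zNc; have := depP z zN Pz; lia.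
  - move=> z zc /andP[/andP[Pz dz] zNc] pc.
    have zN : z < N by lia.
    by have := dep_desc z zN Pz dz zNc; have := dep_par z zN Pz; lia.
  - move=> t tc; apply: leq_trans (over t (ltn_trans tc cN)).
    have -> : N = c + (N - c) by lia.
    rewrite iotaD count_cat; apply: leq_trans (leq_addr _ _).
    by apply: sub_count => z /= /andP[/andP[/andP[-> _] _] ->].
(* Before [z0] there is no interval at all; from [z0] on some descendant of [c] covers each time, so
   dropping the descendants lowers the overlap. *)
have bound_other : count (fun z => P z && ~~ desc z) (iota 0 N)
    < 'C(K.-1 + e, e).
  apply: (IHm _ _ _ _ dep) => //.
  - by lia.
  - move=> z zN /andP[Pz]; rewrite descE negb_or => /andP[_ dp].
    by case: (parP z zN Pz) => [->|[pN Pp]]; [left | right; rewrite Pp].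
  - by move=> z zN /andP[Pz _]; apply: depP.
  - by move=> z zN /andP[Pz _]; apply: dep_par.
  - move=> t tN; have [tz0|z0t] := ltnP t z0.
      rewrite (@eq_in_count _ _ pred0) ?count_pred0 // => z.
      rewrite mem_iota => zN /=; apply/negbTE/negP.
      case/andP => /andP[Pz _] zt; have := z0min z; rewrite Pz zN => /(_ isT).
      by lia.
    have [z' [Pz' /asboolP dz' tz']] := cover_chain par_gt parP parc tN Pz0 z0t z0c.
    have := over t tN; rewrite (count_predUC _ desc) => le_K.
    have : 0 < count (fun z => P z && (z <= t < par z) && desc z) (iota 0 N).
      rewrite -has_count; apply/hasP; exists z'; first by rewrite mem_iota; lia.
      by apply/andP; split; [rewrite Pz' | exact: dz'].
    rewrite (@eq_count _ (fun z => P z && ~~ desc z && (z <= t < par z))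
      (fun z => P z && (z <= t < par z) && ~~ desc z)); first by lia.
    by move=> z /=; rewrite -!andbA; congr andb; rewrite andbC andbA.
(* Both bounds are strict, which leaves room for [c] itself in Pascal's rule. *)
rewrite eqcount; case: (K) (e) K0 e0 bound_desc bound_other => // K' [] // e' _ _.
rewrite !succnK -addSnnS => lt_desc lt_other; rewrite [K'.+1 + _]addnS binS.
by move: lt_desc lt_other; lia.
Qed.

(** * Remaining rewrites and the potential argument, on an abstract trace of blocks *)

Lemma foldr_minn_le (d : nat) (s : seq nat) (x : nat) :
  x \in s -> foldr minn d s <= x.
Proof.
elim: s => //= y s IHs; rewrite inE => /predU1P[->|/IHs]; first exact: geq_minl.
exact/leq_trans/geq_minr.
Qed.

Lemma foldr_minn_mem (d : nat) (s : seq nat) :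
  foldr minn d s < d -> foldr minn d s \in s.
Proof.
elim: s => [|y s IHs] /=; first by rewrite ltnn.
rewrite inE /minn; case: (ltnP y) => _; first by rewrite eqxx.
by move=> /IHs ->; rewrite orbT.
Qed.

Lemma foldr_minn_bound (d : nat) (s : seq nat) : foldr minn d s <= d.
Proof. by elim: s => //= y s IHs; apply: leq_trans IHs; apply: geq_minr. Qed.

Section BlockTrace.

(* At time [z], [z] items are stored; of the [len z a] words of block [a],
   [f z a] have been written since its allocation.  [sv z.+1 a] says that the
   block [a] survives from time [z] to [z.+1], and [w z a] counts writes. *)
Variables (n A S K d : nat) (alive sv : nat -> pred nat).
Variables (len f w : nat -> nat -> nat).

Hypothesis d_gt0 : 0 < d.
Hypothesis sv0 : forall a, sv 0 a = false.
Hypothesis sv_alive : forall z a, z < n -> sv z.+1 a -> alive z.+1 a.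
Hypothesis dead_len : forall z a, z <= n -> ~~ alive z a -> len z a = 0.
Hypothesis f_le_len : forall z a, z <= n -> f z a <= len z a.
Hypothesis f0 : forall a, f 0 a = 0.
Hypothesis sv_len : forall z a, z < n -> sv z.+1 a -> len z.+1 a = len z a.
Hypothesis sv_f : forall z a, z < n -> sv z.+1 a -> f z a <= f z.+1 a.
Hypothesis f_write : forall z a, z < n ->
  f z.+1 a <= (if sv z.+1 a then f z a else 0) + w z.+1 a.
Hypothesis space_le : forall z, z <= n -> \sum_(a < A) len z a <= z + S.
Hypothesis items_ge : forall z, z <= n -> z <= \sum_(a < A) f z a.
Hypothesis blocks_le : forall z, z <= n -> count (alive z) (iota 0 A) <= K.

Let newborn z a := alive z a && ~~ sv z a.

Let least_hops z (mu : nat -> nat) :=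
  foldr minn d [seq (mu a).+1 | a <- iota 0 A & newborn z a].

(** The future of a block determines its value, so the recursion is on the time [k] left until
    [n]. *)
Fixpoint hops_before k a : nat :=
  if k is k'.+1 then
    if sv (n - k') a then hops_before k' a
    else least_hops (n - k') (hops_before k')
  else 0.

(* [mu z a] bounds from below the number of times that an item of block [a]
   must still be moved until time [n], ignoring moves into surviving blocks;
   [lam z] is the same for an item that is about to be moved at time [z]. *)
Let mu z := hops_before (n - z).
Let lam z := least_hops z (mu z).

Let muE z a : z < n -> mu z a = if sv z.+1 a then mu z.+1 a else lam z.+1.
Proof.
by move=> zn; rewrite /lam /mu -[n - z]prednK ?subn_gt0 //= -subnS subKn.
Qed.

Let lam_le_d z : lam z <= d. Proof. exact: foldr_minn_bound. Qed.

Let lam_le z a : a < A -> newborn z a -> lam z <= (mu z a).+1.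
Proof.
move=> aA za; apply: foldr_minn_le; apply: (map_f (fun a => (mu z a).+1)).
by rewrite mem_filter za mem_iota.
Qed.

Let lam_gt0 z : 0 < lam z.
Proof.
have [/foldr_minn_mem/mapP[a _ eq_lam]|] := ltnP (lam z) d; last exact: leq_trans.
by rewrite /lam /least_hops eq_lam.
Qed.

Let lam_attained z : lam z < d ->
  exists a, [/\ a < A, newborn z a & lam z = (mu z a).+1].
Proof.
move=> /foldr_minn_mem/mapP[a]; rewrite mem_filter mem_iota => /andP[za aA].
by exists a.
Qed.

Let short z := lam z < d.

(** Each short [z] gets a newborn block attaining [lam z], its carrier, and the interval from [z] to
    the exit of that carrier. If the exit [par z] is at most [n], then [lam z = (lam (par z)).+1]:
    hence [par z] is short too, and [lam] serves as the depth, between [1] and [d.-1]. *)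
Let short_count : count short (iota 0 n.+1) < 'C(K + d.-1, d.-1).
Proof.
have carrierP z : exists a, short z ->
    [/\ a < A, newborn z a & lam z = (mu z a).+1].
  by case: (boolP (short z)) => [/lam_attained[a]|_]; [exists a | exists 0].
pose carrier z := projT1 (cid (carrierP z)).
have carrierE z : short z -> [/\ carrier z < A, newborn z (carrier z) &
    lam z = (mu z (carrier z)).+1] by rewrite /carrier; case: cid.
(* The maximum provides an exit for [z > n] as well, since [forest_count] wants [z < par z] for
   every [z]. *)
have exit z : exists p, (z < p) && ((n < p) || ~~ sv p (carrier z)).
  by exists (maxn z.+1 n.+1); lia.
pose par z := ex_minn (exit z).
have par_gt z : z < par z by rewrite /par; case: ex_minnP => p /andP[].
have par_le z : z <= n -> par z <= n.+1.
  move=> zn; rewrite /par; case: ex_minnP => p _; apply.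
  by rewrite ltnS zn ltnSn.
have par_exit z : par z <= n -> ~~ sv (par z) (carrier z).
  by rewrite /par; case: ex_minnP => p /andP[_ /orP[|//]]; lia.
have par_sv z p : z < p -> p < par z -> sv p (carrier z).
  rewrite /par; case: ex_minnP => q _ qmin zp pq; apply: contraTT pq => svp.
  by rewrite -leqNgt; apply: qmin; rewrite zp svp orbT.
have mu_par z p : z <= p -> p < par z -> p <= n ->
    mu z (carrier z) = mu p (carrier z).
  elim: p => [|p IHp]; first by case: z.
  rewrite leq_eqVlt => /predU1P[-> //|zp] pp pn.
  by rewrite IHp ?(@muE p) ?par_sv //; lia.
have mu_exit z : z <= n -> par z <= n -> mu z (carrier z) = lam (par z).
  move=> zn pn; have := par_gt z; have := par_exit z pn.
  case: (par z) (@par_sv z) (@mu_par z) pn => // p _ mu_p pn /negbTE nsv zp.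
  by rewrite (mu_p p) ?(@muE p) ?nsv //; lia.
apply: (@forest_count _ _ _ _ par lam) => //.
- move=> z zn /carrierE[_ _ eq_lam].
  have := par_le z zn; rewrite leq_eqVlt => /predU1P[->|pn]; [by left | right].
  split => //; rewrite /short -mu_exit //.
  by have := lam_le_d z; lia.
- by move=> z zn; rewrite /short lam_gt0 /=; lia.
- move=> z zn /carrierE[_ _ ->] pn; rewrite mu_exit //; lia.
(* Intervals through [t] have distinct carriers alive at [t]: the carrier of an earlier one still
   survives at the start of a later one, so it is not newborn there. *)
- move=> t tn; apply: leq_trans (blocks_le (tn : t <= n)).
  pose Z := [seq z <- iota 0 n.+1 | short z && (z <= t < par z)].
  rewrite -!size_filter -/Z -(size_map carrier Z); apply: uniq_leq_size.
    rewrite map_inj_in_uniq ?filter_uniq ?iota_uniq // => z1 z2.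
    rewrite !mem_filter => /andP[/andP[sz1 zt1] _] /andP[/andP[sz2 zt2] _] eqc.
    have [_ /andP[_ nsv1] _] := carrierE _ sz1.
    have [_ /andP[_ nsv2] _] := carrierE _ sz2.
    have [lt12|lt21|//] := ltngtP z1 z2.
      by move: nsv2; rewrite -eqc par_sv //; lia.
    by move: nsv1; rewrite eqc par_sv //; lia.
  move=> _ /mapP[z + ->]; rewrite !mem_filter => /andP[/andP[sz zt] _].
  have [cA /andP[az _] _] := carrierE _ sz; rewrite mem_iota cA.
  have [->|ltzt] := eqVneq t z; first by rewrite az.
  have tp : t = t.-1.+1 by lia.
  by rewrite andbT tp sv_alive -?tp ?par_sv //; lia.
Qed.

Let E z a := len z a - f z a.

(* What a free word may cost later, when an item is moved to it instead of to
   a newly allocated block. *)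
Let q z a := d - (mu z a).+1.

Let F z := \sum_(a < A) f z a.
Let Q z := \sum_(a < A) E z a * q z a.
Let P z := \sum_(a < A) f z a * mu z a.
Let W z := \sum_(a < A) w z a.

Let free_le z : z <= n -> \sum_(a < A) E z a <= S.
Proof.
move=> zn; have := space_le zn; have := items_ge zn.
have -> : \sum_(a < A) len z a = \sum_(a < A) E z a + \sum_(a < A) f z a.
  by rewrite -big_split; apply: eq_bigr => a _; rewrite /E /= subnK ?f_le_len.
lia.
Qed.

(** The inequality holds block by block. In a surviving block [mu] keeps its value [m], and a newly
    filled word pays for [lam z.+1 <= d] by its write, its share [m] of [P z.+1] and the [d - m.+1]
    that leaves [Q]. In a newborn block [lam z.+1 <= m.+1], so the write and the share of [P z.+1]
    suffice; free words of newborn blocks add at most [S * (d - lam z.+1)] to [Q z.+1]. Words of a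
    block that does not survive have [mu z a = lam z.+1], which cancels against [lam z.+1 * F z]. *)
Let step z : z < n ->
  lam z.+1 * F z.+1 + Q z.+1 + P z
    <= W z.+1 + P z.+1 + Q z + lam z.+1 * F z + S * (d - lam z.+1).
Proof.
move=> zn; apply: leq_trans (leq_add (leqnn _) (leq_mul (free_le zn) (leqnn _))).
rewrite !big_distrr big_distrl -!big_split; apply: leq_sum => -[a /= aA] _.
rewrite /q (muE a zn); have lam_d := lam_le_d z.+1; have fl := f_le_len a (ltnW zn).
have fl' := @f_le_len z.+1 a zn; have fw := f_write a zn.
case: ifPn => sva.
  rewrite sva in fw; have ff := sv_f zn sva; have ll := sv_len zn sva.
  rewrite /E ll.
  move: fw ff; set x := f z a; set y := f z.+1 a; set m := mu _ _ => fw ff.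
  have -> : len z a - x = (len z a - y) + (y - x) by lia.
  have -> : y = x + (y - x) by lia.
  have : (y - x) * lam z.+1 <= (y - x) * (1 + m + (d - m.+1)).
    by rewrite leq_mul2l; lia.
  have : y - x <= w z.+1 a by lia.
  rewrite addKn; move: (y - x) (len z a - _) (d - m.+1) (d - _) => u v b c.
  by clear; nia.
rewrite (negPf sva) in fw.
have [al|/(@dead_len z.+1 _ zn) len0] := boolP (alive z.+1 a); last first.
  have f'0 : f z.+1 a = 0 by lia.
  by rewrite /E len0 f'0 !mul0n muln0 (mulnC (f z a)); lia.
have := lam_le aA (introT andP (conj al sva)).
move: (E _ _) (E _ _) (mu z.+1 a) (lam z.+1) lam_d => E1 E2 m l ld lm.
have : E1 * (d - m.+1) <= E1 * (d - l) by rewrite leq_mul2l; lia.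
have : l * f z.+1 a <= f z.+1 a * m.+1 by nia.
nia.
Qed.

(** A step with [lam z.+1 = d] loses nothing. A short one loses at most [d * S.*2.+1]: since [F]
    stays between [z] and [z + S], it grows by at most [S.+1], so replacing [lam z.+1] by [d] costs
    [(d - lam z.+1) * S.+1], and [step] loses a further [S * (d - lam z.+1)]. *)
Let potential z : z <= n ->
  d * F z + Q z <= \sum_(1 <= y < z.+1) W y + P z
                   + d * (S.*2.+1 * count short (iota 0 z.+1)).
Proof.
elim: z => [|z IHz] zn.
  have -> : F 0 = 0 by rewrite /F big1.
  rewrite big_geq // /= muln0 !add0n addn0; apply: leq_trans (leq_addl _ _).
  (* The empty array may own free words. Its blocks all count as newborn, so these words cost
     nothing unless time [0] is short. *)
  apply: (@leq_trans (S * (d - lam 0))); last first.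
    rewrite /short; have := lam_le_d 0; have := lam_gt0 0.
    by case: ltngtP => //; nia.
  apply: leq_trans (leq_mul (free_le zn) (leqnn _)).
  rewrite big_distrl; apply: leq_sum => -[a /= aA] _.
  have [al|/(dead_len zn) len0] := boolP (alive 0 a); last by rewrite /E len0.
  have /(lam_le aA) : newborn 0 a by rewrite /newborn al sv0.
  by rewrite /q leq_mul2l; lia.
have IH := IHz (ltnW zn); have st := step zn.
have F_le : F z.+1 <= F z + S.+1.
  apply: leq_trans (_ : z.+1 + S <= _); last by rewrite addSnnS leq_add2r items_ge // ltnW.
  apply: leq_trans (space_le zn); apply: leq_sum => a _; exact: f_le_len.
have := lam_le_d z.+1; have := lam_gt0 z.+1.
have -> : count short (iota 0 z.+2) = count short (iota 0 z.+1) + (lam z.+1 < d).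
  by rewrite -[z.+2]addn1 iotaD count_cat [count _ (iota (0 + _) _)]/= addn0.
have -> : \sum_(1 <= y < z.+2) W y = \sum_(1 <= y < z.+1) W y + W z.+1.
  by rewrite big_nat_recr.
move: F_le IH st; move: (lam _) (F z.+1) (count _ _) (\sum_(1 <= i < _) _).
move=> l F' c T F_le IH st l0 ld.
have -> : d * F' = l * F' + (d - l) * F' by rewrite -mulnDl subnKC.
have : (d - l) * F' <= (d - l) * F z + (d - l) * S.+1.
  by rewrite -mulnDr leq_mul2l F_le orbT.
have : d * F z = l * F z + (d - l) * F z by rewrite -mulnDl subnKC.
have : (d - l) * S.+1 + S * (d - l) <= d * (S.*2.+1 * (l < d)).
  by case: ltngtP ld => //; nia.
rewrite (mulnDr S.*2.+1) (mulnDr d); lia.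
Qed.

(** This is [potential] at time [n], where no rewrite remains and [P n = 0]. *)
Lemma trace_writes_ge :
  d * n <= \sum_(1 <= z < n.+1) \sum_(a < A) w z a
           + d * (S.*2.+1 * 'C(K + d.-1, d.-1)).
Proof.
apply: leq_trans (_ : d * F n + Q n <= _).
  by apply: leq_trans (leq_addr _ _); rewrite leq_mul2l items_ge ?orbT.
apply: leq_trans (potential (leqnn n)) _.
have -> : P n = 0 by rewrite /P big1 // => a _; rewrite /mu subnn muln0.
by rewrite addn0 leq_add2l !leq_mul2l (ltnW short_count) !orbT.
Qed.

(** The crude bound of one write per item, for the case of bounded [r]. *)
Lemma trace_writes_ge_items :
  n <= \sum_(1 <= z < n.+1) \sum_(a < A) w z a.
Proof.
suff h z : z <= n -> F z <= \sum_(1 <= y < z.+1) W y.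
  by apply: leq_trans (h _ (leqnn n)); apply: items_ge.
elim: z => [|z IHz] zn; first by rewrite /F big1.
rewrite big_nat_recr //=; apply: leq_trans (_ : F z + W z.+1 <= _); last first.
  by rewrite leq_add2r IHz // ltnW.
rewrite -big_split; apply: leq_sum => a _; apply: leq_trans (f_write a zn) _.
by rewrite leq_add2r; case: ifP.
Qed.

End BlockTrace.

(** * Memory: survival of blocks, origin of items, number of blocks *)

Local Open Scope fmap_scope.

Definition block_len (T : Type) (sg : state T) (a : address) : nat :=
  size (odflt [::] (heap sg).[? a]).

(** An address freed and then allocated again is listed too: it names a new block. *)
Definition freed (p : seq instr) : seq address :=
  pmap (fun i => if i is Free b then Some b else None) p.

Definition written (p : seq instr) : seq location :=
  pmap (fun i => match i with Copy _ l | Put l => Some l | _ => None end) p.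

Definition has_item (T : Type) (sg : state T) (l : location) : bool :=
  if lookup sg l is Some (Item _) then true else false.

Lemma size_written (p : seq instr) : size (written p) = cost p.
Proof. by elim: p => //= i p IHp; rewrite /cost /= -/(cost p) -IHp; case: i. Qed.

Lemma lookup_range (T : Type) (sg : state T) (l : location) w :
  lookup sg l = Some w -> l.1 \in domf (heap sg) /\ l.2 < block_len sg l.1.
Proof.
rewrite /lookup /block_len; case: fndP => //= kf; rewrite onthE => h.
split=> //; rewrite ltnNge; apply/negP => le_size.
by move: h; rewrite nth_default ?size_map.
Qed.

Lemma onth_set_nth (T : Type) (x : T) (s : seq T) (i j : nat) :
  i < size s -> onth (set_nth x s i x) j = if j == i then Some x else onth s j.
Proof.
move=> i_s; rewrite !onthE; have [js|sj] := ltnP j (size s).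
  rewrite (nth_map x) ?size_set_nth ?(maxn_idPr i_s) // nth_set_nth /=.
  by case: eqP => // _; rewrite (nth_map x).
rewrite !nth_default ?size_map ?size_set_nth ?(maxn_idPr i_s) //.
by case: eqP => // ji; move: i_s; rewrite -ji ltnNge sj.
Qed.

Lemma store_some (T : Type) (sg sg' : state T) (l : location) (w : word T) :
    store sg l w = Some sg' ->
  [/\ forall a, (a \in domf (heap sg')) = (a \in domf (heap sg)),
      forall a, block_len sg' a = block_len sg a &
      forall l', lookup sg' l' = if l' == l then Some w else lookup sg l'].
Proof.
rewrite /store; case: fndP => // kf; case: ifP => // ls [<-]; split.
- by move=> a /=; rewrite !inE; have [->|//] := eqVneq a l.1; rewrite kf.
- move=> a; rewrite /block_len /= fnd_set; have [->|//] := eqVneq a l.1.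
  by rewrite in_fnd /= size_set_nth (maxn_idPr ls).
- move=> [a o]; rewrite /lookup /= fnd_set -[(a, o) == l]/((a == l.1) && (o == l.2)).
  by have [->|//] := eqVneq a l.1; rewrite /= onth_set_nth ?in_fnd.
Qed.

Lemma exec1_survive (T : Type) x (sg sg' : state T) i a :
    exec1 x sg i = Some sg' -> i <> Free a -> a \in domf (heap sg) ->
  a \in domf (heap sg') /\ block_len sg' a = block_len sg a.
Proof.
case: i => [b m|b|src dst|dst|dst b|dst k|b] /=.
- case: ifP => // bN [<-] _ aD /=; rewrite !inE aD orbT /block_len /= fnd_set.
  by have [ab|//] := eqVneq a b; rewrite -ab aD in bN.
- case: ifP => // _ [<-] ab aD; rewrite /block_len /= fnd_rem1 !inE aD andbT.
  by have [eq_ab|//] := eqVneq a b; case: ab; rewrite eq_ab.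
- by case: lookup => // -[] // y /store_some[dE lE _] _ aD; rewrite dE lE.
- by case: x => // y /store_some[dE lE _] _ aD; rewrite dE lE.
- by move=> /store_some[dE lE _] _ aD; rewrite dE lE.
- by move=> /store_some[dE lE _] _ aD; rewrite dE lE.
- by move=> [<-].
Qed.

(** Only [Copy] and [Put] create items: [Alloc] fills its block with [Data 0], and the other stores
    write a pointer or a number. *)
Lemma exec1_item (T : Type) x (sg sg' : state T) i l :
    exec1 x sg i = Some sg' -> has_item sg' l ->
  l \in written [:: i] \/ has_item sg l /\ i <> Free l.1.
Proof.
rewrite /has_item.
case: i => [b m|b|src dst|dst|dst b|dst k|b] /=.
- case: ifP => // bN [<-] h; right; split => //; move: h.
  rewrite /lookup /= fnd_set; have [_|//] /= := eqVneq l.1 b.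
  rewrite onthE; case: (ltnP l.2 m) => lm; last first.
    by rewrite nth_default // size_map size_nseq.
  by rewrite (nth_map (Data 0)) ?size_nseq // nth_nseq lm.
- case: ifP => // _ [<-] h; right; move: h; rewrite /lookup /= fnd_rem1.
  by have [//|lb] := eqVneq l.1 b; split => // -[lb']; rewrite lb' eqxx in lb.
- case: lookup => // -[] // y /store_some[_ _ ->]; rewrite /written /= inE.
  by have [_|_ h] := eqVneq l dst; [left | right].
- case: x => // y /store_some[_ _ ->]; rewrite /written /= inE.
  by have [_|_ h] := eqVneq l dst; [left | right].
- by move=> /store_some[_ _ ->]; have [//|_ h] := eqVneq l dst; right.
- by move=> /store_some[_ _ ->]; have [//|_ h] := eqVneq l dst; right.
- by move=> [<-] h; right.
Qed.

Lemma exec_survive (T : Type) x (sg sg' : state T) p a :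
    exec x sg p = Some sg' -> a \notin freed p -> a \in domf (heap sg) ->
  a \in domf (heap sg') /\ block_len sg' a = block_len sg a.
Proof.
elim: p sg => [|i p IHp] sg /=; first by case=> ->.
case e1: exec1 => [sg1|] //= ep aF aD.
have [|aD1 <-] := exec1_survive e1 _ aD.
  by move=> ei; move: aF; rewrite ei /freed /= inE eqxx.
apply: IHp => //; apply: contraNN aF; rewrite /freed /=.
by case: (i) => //= b; rewrite inE => ->; rewrite orbT.
Qed.

Lemma exec_item (T : Type) x (sg sg' : state T) p l :
    exec x sg p = Some sg' -> has_item sg' l ->
  l \in written p \/ has_item sg l /\ l.1 \notin freed p.
Proof.
elim: p sg => [|i p IHp] sg /=; first by case=> -> ?; right.
case e1: exec1 => [sg1|] //= ep /(IHp _ ep) [lw|[ls lF]].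
  by left; rewrite -[_ \in _]/(l \in written ([:: i] ++ p)) /written pmap_cat mem_cat; apply/orP; right.
have [lw|[ls' nf]] := exec1_item e1 ls; [left|right; split => //].
  by rewrite -[_ \in _]/(l \in written ([:: i] ++ p)) /written pmap_cat mem_cat; apply/orP; left.
move: nf lF; rewrite /freed /=; case: (i) => //= b nf; rewrite inE negb_or => ->.
by rewrite andbT; apply/eqP => lb; apply: nf; rewrite lb.
Qed.

(** Without an argument [Put] faults, and [Copy] needs an item to copy; so creation leaves no item
    in memory. *)
Lemma exec_no_item (T : Type) (sg sg' : state T) p :
    exec None sg p = Some sg' -> (forall l, has_item sg l = false) ->
  forall l, has_item sg' l = false.
Proof.
elim: p sg => [|i p IHp] sg /=; first by case=> <-.
case e1: exec1 => [sg1|] //= ep no_item; apply: IHp ep _ => l.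
apply/negP => il; have [lw|[]] := exec1_item e1 il; last by rewrite no_item.
case: i e1 lw => // src dst /=.
by have := no_item src; rewrite /has_item; case: lookup => // -[].
Qed.

Definition locations (T : Type) (M : nat) (sg : state T) : seq location :=
  [seq (a, o) | a <- iota 0 M, o <- iota 0 (block_len sg a)].

Lemma mem_locations (T : Type) (M : nat) (sg : state T) (l : location) :
  (l \in locations M sg) = (l.1 < M) && (l.2 < block_len sg l.1).
Proof.
case: l => a o; apply/allpairsPdep/andP => /= [[b [k [bM kb [-> ->]]]]|[aM oa]].
  by move: bM kb; rewrite !mem_iota.
by exists a, o; rewrite !mem_iota.
Qed.

Lemma locations_uniq (T : Type) (M : nat) (sg : state T) :
  uniq (locations M sg).
Proof.
apply: allpairs_uniq_dep; rewrite ?iota_uniq //; first by move=> *; apply: iota_uniq.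
by move=> [a o] [b k] _ _ /= [-> ->].
Qed.

Lemma count_locations (T : Type) (M : nat) (sg : state T) (P : pred location) :
  count P (locations M sg) =
  \sum_(a < M) count (fun o => P (a : nat, o)) (iota 0 (block_len sg a)).
Proof.
rewrite -(big_mkord xpredT (fun a =>
  count (fun o => P (a, o)) (iota 0 (block_len sg a)))) /index_iota subn0.
rewrite /locations; elim: (iota 0 M) => [|a s IHs] /=; first by rewrite big_nil.
by rewrite big_cons count_cat IHs count_map.
Qed.

Lemma space_usedE (T : Type) (M : nat) (sg : state T) :
    (forall b, b \in domf (heap sg) -> b < M) ->
  space_used sg = \sum_(a < M) block_len sg a.
Proof.
move=> ltM; rewrite /space_used.
rewrite (eq_bigr (fun b => block_len sg (val b))); last first.
  move=> b _; rewrite /block_len in_fnd ?fsvalP //= => kf.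
  by congr (size (heap sg _)); apply: val_inj.
rewrite -(big_seq_fsetE _ _ xpredT (fun b => block_len sg b)) /=.
rewrite -(big_mkord xpredT (block_len sg)).
apply: esym; rewrite (bigID (fun b => b \in domf (heap sg))) /= [X in _ + X = _]big1 => [|b bN].
  rewrite addn0 -big_filter; apply/perm_big/uniq_perm.
  - exact/filter_uniq/iota_uniq.
  - exact: fset_uniq.
  - by move=> b; rewrite mem_filter mem_index_iota; case: (boolP (b \in _)) => [/ltM->|].
by rewrite /block_len not_fnd.
Qed.

(** A word has a single value, so the words of the items and one pointer word for each block other
    than the index block are all distinct. The successor accounts for the index block. *)
Lemma items_blocks_le (T : Type) (A : implementation T) (M : nat)
    (sg : state T) (a : seq T) :
    (forall b, b \in domf (heap sg) -> b < M) ->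
    represents A sg a -> well_pointed sg ->
  size a + count (mem (domf (heap sg))) (iota 0 M) <= (space_used sg).+1.
Proof.
move=> ltM [_ loc_inj loc_item] [_ pointed].
have ptrP b : exists l, (b \in domf (heap sg)) && (b != index_block sg) ->
    lookup sg l = Some (Pointer b).
  case: (boolP (_ && _)) => [/andP[bD bI]|_]; last by exists (0, 0).
  by have [l lb] := pointed b bD bI; exists l.
pose ptr b := projT1 (cid (ptrP b)).
have ptrE b : (b \in domf (heap sg)) && (b != index_block sg) ->
    lookup sg (ptr b) = Some (Pointer b) by rewrite /ptr; case: cid.
pose L1 := [seq loc A sg i | i <- iota 0 (size a)].
pose B := [seq b <- iota 0 M | (b \in domf (heap sg)) && (b != index_block sg)].
have lookup1 i : i < size a -> exists x, lookup sg (loc A sg i) = Some (Item x).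
  move=> ia; rewrite loc_item //; have := onthTE a i; rewrite ia.
  by case: onth => // x _; exists x.
have uniqL : uniq (L1 ++ [seq ptr b | b <- B]).
  rewrite cat_uniq; apply/and3P; split.
  - rewrite map_inj_in_uniq ?iota_uniq // => i j; rewrite !mem_iota.
    by move=> ia ja; apply: loc_inj.
  - apply/hasPn => _ /mapP[b + ->]; rewrite mem_filter => /andP[/ptrE pb _].
    apply/mapP => -[i]; rewrite mem_iota => /lookup1[x lx] eq_l.
    by rewrite eq_l lx in pb.
  - rewrite map_inj_in_uniq ?filter_uniq ?iota_uniq // => b b'.
    rewrite !mem_filter => /andP[/ptrE pb _] /andP[/ptrE pb' _] eq_p.
    by move: pb; rewrite eq_p pb' => -[].
have subL : {subset L1 ++ [seq ptr b | b <- B] <= locations M sg}.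
  move=> l lL; have [v lv] : exists v, lookup sg l = Some v.
    move: lL; rewrite mem_cat => /orP[/mapP[i]|/mapP[b]].
      by rewrite mem_iota => /lookup1[x lx] ->; exists (Item x).
    by rewrite mem_filter => /andP[/ptrE pb _] ->; exists (Pointer b).
  by have [lD ll] := lookup_range lv; rewrite mem_locations ltM.
have := uniq_leq_size uniqL subL.
rewrite size_cat !size_map size_iota (space_usedE ltM) => le_size.
have -> : \sum_(b < M) block_len sg b = size (locations M sg).
  rewrite -count_predT count_locations; apply: eq_bigr => b _.
  by rewrite count_predT size_iota.
rewrite (count_predUC _ (pred1 (index_block sg))).
have : count (fun b => mem (domf (heap sg)) b && pred1 (index_block sg) b)
    (iota 0 M) <= 1.
  apply: leq_trans (_ : count (pred1 (index_block sg)) (iota 0 M) <= 1).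
    by apply: sub_count => b /andP[].
  by rewrite count_uniq_mem ?iota_uniq //; case: (_ \in _).
rewrite [X in _ + (X + _)](_ : _ = size B).
  by move=> le1; rewrite addnA -addn1; apply: leq_add.
by rewrite size_filter; apply: eq_count.
Qed.

(** * From a run of programs to a block trace *)

Section Run.

Variables (T : Type) (n S K M : nat) (sg : nat -> state T).
Variables (p : nat -> seq instr) (x : nat -> option T).

Hypothesis exec_run : forall z, z < n -> exec (x z) (sg z) (p z) = Some (sg z.+1).
Hypothesis no_item : forall l, has_item (sg 0) l = false.
Hypothesis dom_lt : forall z b, z <= n -> b \in domf (heap (sg z)) -> b < M.
Hypothesis space_le : forall z, z <= n -> space_used (sg z) <= z + S.
Hypothesis items_ge : forall z, z <= n ->
  z <= count (has_item (sg z)) (locations M (sg z)).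
Hypothesis blocks_le : forall z, z <= n ->
  count (mem (domf (heap (sg z)))) (iota 0 M) <= K.

Let sv z a :=
  if z is z'.+1 then (a \in domf (heap (sg z'))) && (a \notin freed (p z'))
  else false.

(* A word stays occupied when its item is discarded, until its block is freed:
   so occupied words disappear only with their block. *)
Fixpoint occupied z : pred location :=
  if z is z'.+1 then
    fun l => sv z'.+1 l.1 && occupied z' l || (l \in written (p z'))
  else xpred0.

Let f z a := count (fun o => occupied z (a, o)) (iota 0 (block_len (sg z) a)).
Let w z a :=
  count (fun o => (a, o) \in written (p z.-1)) (iota 0 (block_len (sg z) a)).

Let item_occupied z l : z <= n -> has_item (sg z) l -> occupied z l.
Proof.
elim: z l => [|z IHz] l zn; first by rewrite no_item.
move=> /(exec_item (exec_run zn))[lw|[ls lF]] /=; first by rewrite lw orbT.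
rewrite lF IHz // 1?ltnW // andbT.
suff -> : l.1 \in domf (heap (sg z)) by [].
by move: ls; rewrite /has_item; case lE: lookup => [v|] // _; have [] := lookup_range lE.
Qed.

Let sv_alive z a : z < n -> sv z.+1 a ->
  a \in domf (heap (sg z.+1)) /\ block_len (sg z.+1) a = block_len (sg z) a.
Proof. by move=> zn /andP[aD aF]; apply: exec_survive (exec_run zn) aF aD. Qed.

(** Only an inequality: a word may be written twice, or lie in a block that [p z] frees. *)
Let write_le z : \sum_(a < M) w z.+1 a <= cost (p z).
Proof.
rewrite -(count_locations M (sg z.+1) (mem (written (p z)))) -size_filter.
rewrite -size_written; apply: uniq_leq_size; first exact/filter_uniq/locations_uniq.
by move=> l; rewrite mem_filter => /andP[].
Qed.

Let cost_ge : \sum_(1 <= z < n.+1) \sum_(a < M) w z a <= \sum_(z < n) cost (p z).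
Proof.
by rewrite big_add1 /= big_mkord; apply: leq_sum => z _; apply: write_le.
Qed.

Let f_write z a : z < n ->
  f z.+1 a <= (if sv z.+1 a then f z a else 0) + w z.+1 a.
Proof.
move=> zn; rewrite /f /w; case: ifP => sva.
  have [_ ->] := sv_alive zn sva; rewrite -count_predUI.
  apply: leq_trans (leq_addr _ _); apply: sub_count => o /=.
  by move=> /orP[/andP[_ ->]|->] //; rewrite orbT.
by apply: sub_count => o /=; move: sva => /= ->.
Qed.

Let items_filled z : z <= n -> z <= \sum_(a < M) f z a.
Proof.
move=> zn; apply: leq_trans (items_ge zn) _.
rewrite -(count_locations M (sg z) (occupied z)).
by apply: sub_count => l; apply: item_occupied.
Qed.

Lemma run_cost_ge_items : n <= \sum_(z < n) cost (p z).
Proof.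
apply: leq_trans cost_ge; apply: (@trace_writes_ge_items _ _ sv f) => //.
by move=> a; rewrite /f count_pred0.
Qed.

Lemma run_cost_ge (d : nat) : 0 < d ->
  d * n <= \sum_(z < n) cost (p z) + d * (S.*2.+1 * 'C(K + d.-1, d.-1)).
Proof.
move=> d0; apply: leq_trans (leq_add cost_ge (leqnn _)).
apply: (@trace_writes_ge _ _ _ _ _ (fun z => mem (domf (heap (sg z)))) sv
  (fun z => block_len (sg z)) f) => //.
- by move=> z a zn /(sv_alive zn)[].
- by move=> z a zn aN; rewrite /block_len not_fnd.
- by move=> z a zn; apply: leq_trans (count_size _ _) _; rewrite size_iota.
- by move=> a; rewrite /f count_pred0.
- by move=> z a zn /(sv_alive zn)[].
- move=> z a zn sva; rewrite /f; have [_ ->] := sv_alive zn sva.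
  by apply: sub_count => o /= ->; move: sva => /= ->.
- by move=> z zn; rewrite -space_usedE ?space_le // => b; apply: dom_lt.
Qed.

End Run.

(** * Growing an empty array *)

Lemma items_count (T : Type) (A : implementation T) (M : nat) (sg : state T)
    (a : seq T) :
    (forall b, b \in domf (heap sg) -> b < M) -> represents A sg a ->
  size a <= count (has_item sg) (locations M sg).
Proof.
move=> ltM [_ loc_inj loc_item].
rewrite -size_filter -[leqLHS](size_iota 0) -(size_map (loc A sg)).
apply: uniq_leq_size.
  rewrite map_inj_in_uniq ?iota_uniq // => i j; rewrite !mem_iota.
  by move=> ia ja; apply: loc_inj.
move=> _ /mapP[i + ->]; rewrite mem_iota => /= ia.
have := loc_item i ia; have := onthTE a i; rewrite ia.
case: (onth a i) => // x _ lx; have [lD ll] := lookup_range lx.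
by rewrite mem_filter /has_item lx mem_locations ltM.
Qed.

Lemma domf_bound (T : Type) (sg : nat -> state T) (n : nat) :
  exists M, forall z b, z <= n -> b \in domf (heap (sg z)) -> b < M.
Proof.
exists (\max_(z < n.+1) \max_(b <- domf (heap (sg z))) b).+1 => z b zn bD.
rewrite ltnS; apply: leq_trans (leq_bigmax (Ordinal (zn : z < n.+1))).
exact: (@leq_bigmax_seq _ _ xpredT (fun b : nat => b)).
Qed.

(** Correctness excludes faults, so the default [0] in [grow_cost] never occurs. *)
Lemma grow_run (T : Type) (A : implementation T) (sg0 : state T) (a xs : seq T) :
    correct A -> reachable A sg0 a ->
  exists (sg : nat -> state T) (p : nat -> seq instr),
    [/\ sg 0 = sg0,
        forall z, z < size xs -> exec (onth xs z) (sg z) (p z) = Some (sg z.+1),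
        forall z, z <= size xs -> reachable A (sg z) (a ++ take z xs) &
        grow_cost A sg0 xs = \sum_(z < size xs) cost (p z)].
Proof.
move=> [_ corr]; elim: xs sg0 a => [|x xs IHxs] sg0 a reach0.
  exists (fun=> sg0), (fun=> [::]); split=> //= [z _|]; last by rewrite big_ord0.
  by rewrite cats0.
have [_ _ /(_ (Grow x) _ erefl)[sg1 exec1]] := corr _ _ reach0.
have reach1 : reachable A sg1 (rcons a x).
  exact: (@reachable_op _ _ sg0 a (Grow x)).
have [sg [p [sg_0 exec_run reach_run costE]]] := IHxs _ _ reach1.
exists (fun z => if z is z'.+1 then sg z' else sg0),
  (fun z => if z is z'.+1 then p z' else program A sg0 (Grow x)); split=> //.
- by case=> [|z] //= zn; [rewrite sg_0 | apply: exec_run].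
- case=> [|z] zn /=; first by rewrite cats0.
  by rewrite -cat_rcons; apply: reach_run.
- by rewrite big_ord_recl /= exec1 costE.
Qed.

Lemma total_grow_cost_ge (R : archiRealDomainType) (T : Type) (s t : nat -> R)
    (A : implementation T) (xs : seq T) (S : nat) :
    st_implementation s t A -> (s (size xs) < S.+1%:R)%R ->
  size xs <= total_grow_cost A xs /\ forall d, 0 < d ->
  d * size xs <= total_grow_cost A xs
                 + d * (S.*2.+1 * 'C(S.+1 + d.-1, d.-1)).
Proof.
move=> [s_mono _ corr space _] s_lt.
have [[sg0 create0] represented] := corr.
have [sg [p [sg_0 exec_run reach costE]]] :=
  grow_run xs corr (reachable_create create0).
have no_item l : has_item (sg 0) l = false.
  rewrite sg_0; apply: (exec_no_item create0) => l'.
  by rewrite /has_item /lookup fnd_fmap0.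
have [M dom_lt] := domf_bound sg (size xs).
have size_take_le z : z <= size xs -> size ([::] ++ take z xs) = z.
  exact: size_takel.
have space_le z : z <= size xs -> space_used (sg z) <= z + S.
  (* Space is an integer and [s] is monotone, so the strict bound at the final size gives [S] at
     every earlier time. *)
  move=> zn; have := space _ _ (reach z zn); rewrite size_take_le // => space_z.
  rewrite -ltnS -addnS -(ltr_nat R) natrD; apply: le_lt_trans space_z _.
  by rewrite ltrD2l; apply: le_lt_trans s_lt; apply: s_mono.
have items_ge z : z <= size xs ->
    z <= count (has_item (sg z)) (locations M (sg z)).
  move=> zn; have [repr _ _] := represented _ _ (reach z zn).
  by have := items_count (fun b => dom_lt z b zn) repr; rewrite size_take_le.
have blocks_le z : z <= size xs ->
    count (mem (domf (heap (sg z)))) (iota 0 M) <= S.+1.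
  move=> zn; have [repr pointed _] := represented _ _ (reach z zn).
  have := items_blocks_le (fun b => dom_lt z b zn) repr pointed.
  rewrite size_take_le // => le_space; rewrite -(leq_add2l z).
  by apply: leq_trans le_space _; rewrite addnS ltnS space_le.
have -> : total_grow_cost A xs = \sum_(z < size xs) cost (p z).
  by rewrite /total_grow_cost create0.
split=> [|d d0]; first exact: run_cost_ge_items exec_run no_item items_ge.
exact: run_cost_ge exec_run no_item dom_lt space_le items_ge blocks_le d d0.
Qed.

(** * Real estimates and the choice of [d] *)

Local Open Scope ring_scope.

(** The left side is one term of the binomial expansion of [(1 + x) ^+ m]. *)
Lemma bin_le_expR (R : realType) (m q : nat) (x : R) :
  0 <= x -> 'C(m, q)%:R * x ^+ q <= expR (x * m%:R).
Proof.
move=> x0; have [qm|mq] := leqP q m; last by rewrite bin_small // mul0r expR_ge0.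
apply: (@le_trans _ _ ((1 + x) ^+ m)).
  rewrite exprDn (bigD1 (Ordinal (qm : (q < m.+1)%N))) //= expr1n mul1r mulr_natl.
  rewrite lerDl; apply: sumr_ge0 => i _.
  by rewrite expr1n mul1r mulrn_wge0 // exprn_ge0.
rewrite [x * _]mulrC expRM_natl lerXn2r ?nnegrE ?expR_ge0 ?addr_ge0 //.
exact: expR_ge1Dx.
Qed.

(** For [r <= R0] one write per item is enough. Otherwise take [d = q.+1] with [q] the truncation of
    [r / g]. With [u] the fourth root of [n], the binomial is at most [u] and [S.*2.+1] at most
    [E / 2 * u ^+ 2]; as [E <= u], the error is at most half of [d * n], and [d >= r / g]. *)
Lemma tradeoff (R : realType) (C D : R) :
  exists2 c : R, 0 < c & forall (n S cost : nat) (r : R),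
    0 < r -> r <= D * ln n%:R -> S%:R <= C * (r * n%:R `^ r^-1) ->
    (n <= cost)%N ->
    (forall d, (0 < d)%N ->
      (d * n <= cost + d * (S.*2.+1 * 'C(S.+1 + d.-1, d.-1)))%N) ->
    c * r <= cost%:R / n%:R.
Proof.
pose C1 := `|C| + 1; pose D1 := `|D| + 1.
have C1_ge1 : 1 <= C1 by rewrite lerDr.
have D1_ge1 : 1 <= D1 by rewrite lerDr.
(* Makes [m / (B * y)] at most [L / 8]. *)
pose B := 8 * (C1 + 2) * D1; pose lB := ln B.
have B_ge1 : 1 <= B by rewrite /B; nra.
have lB_ge0 : 0 <= lB by exact: ln_ge0.
(* Makes [(B * y) ^+ q] at most [expR (L / 8)]. *)
pose g := 8 * (1 + D1 * lB).
have g_ge8 : 8 <= g by rewrite /g; nra.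
pose E := 8 * (2 * C1 + 1) * D1; pose L0 := 4 * ln E.
have E_ge1 : 1 <= E by rewrite /E; nra.
have L0_ge0 : 0 <= L0 by rewrite mulr_ge0 // ln_ge0.
(* From [r > R0] follow [r > 4], hence [y <= u], and [L > L0], hence [E <= u]. *)
pose R0 := 4 + D1 * L0.
have R0_ge4 : 4 <= R0 by rewrite /R0; nra.
exists (R0 + 2 * g)^-1; first by rewrite invr_gt0; lra.
move=> n S cost r r_gt0 r_le S_le cost_ge cost_ge_d.
pose L := ln n%:R : R.
(* [ln] vanishes at [1] and, by convention, at [0], against [0 < r]. *)
have n_gt1 : (1 < n)%N.
  case: n r_le {S_le cost_ge cost_ge_d L} => [|[|n]] //.
    by rewrite ln0 // mulr0 leNgt r_gt0.
  by rewrite ln1 mulr0 leNgt r_gt0.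
have n_gt0 : (0 : R) < n%:R by rewrite ltr0n; lia.
have L_ge0 : 0 <= L by apply: ln_ge0; rewrite ler1n; lia.
have nE : n%:R = expR L by rewrite lnK.
rewrite ler_pdivlMr // -mulrA mulrC ler_pdivrMr; last by lra.
have [r_le_R0|r_gt_R0] := leP r R0.
  have : n%:R <= cost%:R :> R by rewrite ler_nat.
  have := ler0n R cost; nra.
have r_le1 : r <= D1 * L.
  apply: le_trans r_le _; rewrite ler_wpM2r // /D1.
  by have := ler_norm D; lra.
pose y := expR (L / r).
have S_le1 : S%:R <= C1 * (r * y).
  apply: le_trans S_le _.
  rewrite /powR gt_eqF // -/L mulrC [r^-1 * _]mulrC -/y [leLHS]mulrC.
  rewrite ler_wpM2r // ?mulr_ge0 ?expR_ge0 // 1?ltW // /C1.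
  by have := ler_norm C; lra.
have L_gt_L0 : L0 < L.
  by rewrite -(ltr_pM2l (_ : 0 < D1)); [rewrite /R0 in r_gt_R0; lra | lra].
have y_ge1 : 1 <= y by rewrite -expR0 ler_expR divr_ge0 // ltW.
pose u := expR (L / 4).
have y_le_u : y <= u.
  rewrite ler_expR ler_wpM2l // lef_pV2 ?posrE //; lra.
have u_ge_E : E <= u.
  rewrite -[E]lnK ?posrE ?ler_expR; last by lra.
  by rewrite /L0 in L_gt_L0; lra.
have L_le_u : L <= 4 * u.
  by have := expR_ge1Dx (L / 4); rewrite -/u; lra.
have uE : n%:R = u ^+ 4 :> R.
  by rewrite nE /u -expRM_natl; congr expR; field.
pose q := Num.truncn (r / g).
have rg_ge0 : 0 <= r / g by rewrite divr_ge0 //; lra.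
have q_le : q%:R <= r / g by rewrite truncn_le.
have q_gt : r / g < q.+1%:R by apply: truncnS_gt.
have rg_le : r / g <= r.
  by rewrite ler_pdivrMr; [nra | lra].
pose m := (S.+1 + q)%N.
have m_le : m%:R <= (C1 + 2) * (r * y).
  rewrite /m addSnnS natrD -natr1.
  have : r <= r * y by nra.
  lra.
(* Taking [x = (B * y)^-1] in [bin_le_expR] leaves two exponents of at most [L / 8] each. *)
have bin_le : 'C(m, q)%:R <= u.
  have By_gt0 : 0 < B * y by rewrite mulr_gt0 ?expR_gt0 //; lra.
  have := @bin_le_expR R m q (B * y)^-1 _; rewrite invr_ge0 (ltW By_gt0) => /(_ isT).
  rewrite exprVn ler_pdivrMr ?exprn_gt0 // => /le_trans; apply.
  have ByE : B * y = expR (lB + L / r) by rewrite expRD lnK // posrE; lra.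
  have -> : (B * y) ^+ q = expR (q%:R * (lB + L / r)) by rewrite ByE expRM_natl.
  rewrite -expRD ler_expR.
  have x_le : (B * y)^-1 * m%:R <= L / 8.
    rewrite mulrC ler_pdivrMr //; apply: le_trans m_le _.
    apply: (@le_trans _ _ ((C1 + 2) * (D1 * L * y))).
      by rewrite ler_wpM2l ?ler_wpM2r //; lra.
    by rewrite /B le_eqVlt; apply/orP; left; apply/eqP; field.
  have : q%:R * (lB + L / r) <= L / 8.
    apply: (@le_trans _ _ (r / g * (lB + L / r))).
      by rewrite ler_wpM2r // addr_ge0 // divr_ge0 // ltW.
    have -> : r / g * (lB + L / r) = (r * lB + L) / g.
      by field; rewrite !gt_eqF //; lra.
    rewrite ler_pdivrMr; last by lra.
    by rewrite /g; nra.
  lra.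
have S2_le : S.*2.+1%:R <= (4 * (2 * C1 + 1) * D1) * u ^+ 2.
  rewrite -natr1 -muln2 natrM.
  have ry_ge1 : 1 <= r * y by nra.
  apply: (@le_trans _ _ ((2 * C1 + 1) * (r * y))); first by nra.
  have : r * y <= D1 * (4 * u) * u.
    apply: ler_pM => //; [exact: ltW | exact: expR_ge0 |].
    by apply: le_trans r_le1 _; rewrite ler_wpM2l //; lra.
  by rewrite expr2; nra.
have prod_le : S.*2.+1%:R * 'C(m, q)%:R <= n%:R / 2 :> R.
  have u_ge0 : 0 <= u by exact: expR_ge0.
  apply: le_trans (ler_pM _ _ S2_le bin_le) _ => //.
  rewrite uE.
  have -> : 4 * (2 * C1 + 1) * D1 * u ^+ 2 * u = E / 2 * u ^+ 3 by rewrite /E; field.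
  have -> : u ^+ 4 / 2 = u / 2 * u ^+ 3 by rewrite !exprS expr0; field.
  by rewrite ler_wpM2r ?exprn_ge0 //; lra.
have := cost_ge_d q.+1 isT; rewrite -(ler_nat R) natrD !natrM /= -/m => cost_ge_q.
have : q.+1%:R * (S.*2.+1%:R * 'C(m, q)%:R) <= q.+1%:R * (n%:R / 2) :> R.
  by rewrite ler_wpM2l.
have r_le_q : r <= g * q.+1%:R by rewrite mulrC -ler_pdivrMr ?ltW //; lra.
move=> prod_le_q.
have : q.+1%:R * n%:R <= 2 * cost%:R :> R by lra.
have : r * n%:R <= g * q.+1%:R * n%:R by rewrite ler_wpM2r // ltW.
have : 0 <= R0 * cost%:R :> R by rewrite mulr_ge0 //; lra.
move: (n%:R) (cost%:R) (q.+1%:R) => N c d; nra.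
Qed.

Theorem theorem9p1 (R : realType) (C D : R) :
  exists2 c : R, 0 < c &
    forall (r s t : nat -> R) (N0 : nat),
      (forall N, 0 < r N) ->
      (forall N, (N0 <= N)%N -> r N <= D * ln N%:R) ->
      (forall N, (N0 <= N)%N -> s N <= C * (r N * N%:R `^ (r N)^-1)) ->
    forall (T : Type) (A : implementation T),
      st_implementation s t A -> standard s A ->
    forall xs : seq T, (N0 <= size xs)%N ->
      c * r (size xs) <= amortized_grow_cost R A xs.
Proof.
(* With [|C|] the bound is non-negative, so it also holds for the truncation [0] of a negative
   [s (size xs)]. *)
have [c c_gt0 c_le] := tradeoff `|C| D; exists c => // r s t N0 r_gt0 r_le s_le.
move=> T A implA _ xs le_xs.
have [cost_ge cost_ge_d] := total_grow_cost_ge implA (truncnS_gt (s (size xs))).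
apply: c_le cost_ge cost_ge_d; [exact: r_gt0 | exact: r_le |].
have X_ge0 : 0 <= r (size xs) * (size xs)%:R `^ (r (size xs))^-1.
  by rewrite mulr_ge0 ?powR_ge0 ?ltW.
have [s_ge0|s_lt0] := leP 0 (s (size xs)); last first.
  have /trunc0Pn -> : ~~ (1 <= s (size xs)) by rewrite -ltNge; lra.
  by rewrite mulr_ge0.
apply: le_trans (_ : s (size xs) <= _); first by rewrite truncn_le.
by apply: le_trans (s_le _ le_xs) _; rewrite ler_wpM2r ?ler_norm.
Qed.
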